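(* Let $g(q)\in\mathbb Z[q]$. There exists a functor $\overline{\mathsf W}^{g(q)}$ from the category of $\mathbb Z[q]$-algebras to the category of (not necessarily unital) commutative rings such that: (1) for every $\mathbb Z[q]$-algebra $A$, the underlying set of $\overline{\mathsf W}^{g(q)}(A)$ is $A^{\mathbb N}$; (2) for every $\mathbb Z[q]$-algebra homomorphism $f:A\to B$ and every $\alpha\in\overline{\mathsf W}^{g(q)}(A)$, $\overline{\mathsf W}^{g(q)}(f)(\alpha)=f\circ\alpha$; (3) for every $\mathbb Z[q]$-algebra $A$, the map $$\overline\Phi^{g(q)}_A:\overline{\mathsf W}^{g(q)}(A)\to \mathrm{gh}(A),\qquad (a_n)_{n\in\mathbb N}\mapsto\Big(\sum_{d|n}d\big(1-g(q)^{n/d}\big)a_d^{\,n/d}\Big)_{n\in\mathbb N}$$ is a ring homomorphism. Moreover, if $g(q)\neq1$, then $\overline{\mathsf W}^{g(q)}$ is uniquely determined by conditions (1)–(3).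
   Context: A $\mathbb Z[q]$-algebra means a commutative ring with unity together with a unital ring homomorphism from $\mathbb Z[q]$ ($q$ an indeterminate); morphisms are unity-preserving $\mathbb Z[q]$-algebra homomorphisms. For a commutative ring $A$ with unity, $\mathrm{gh}(A)$ is the ring $A^{\mathbb N}$ with componentwise addition and multiplication (regarded as an object of the category of commutative rings). In (3), $g(q)^{n/d}$ acts on $A$ via the $\mathbb Z[q]$-algebra structure. *)

(* Defs.v *)
From HB Require Import structures.
From mathcomp Require Import all_boot all_order all_algebra.
Set Implicit Arguments. Unset Strict Implicit. Unset Printing Implicit Defensive.
Import GRing.Theory.
Local Open Scope ring_scope.

Record rng_ops (T : Type) := RngOps {
  radd : T -> T -> T;
  rmul : T -> T -> T;
  rzero : T;
  ropp : T -> T }.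

Definition is_comrng (T : Type) (o : rng_ops T) : Prop :=
  (forall x y z, radd o x (radd o y z) = radd o (radd o x y) z) /\
      (forall x y, radd o x y = radd o y x) /\
      (forall x, radd o (rzero o) x = x) /\
      (forall x, radd o (ropp o x) x = rzero o) /\
      (forall x y z, rmul o x (rmul o y z) = rmul o (rmul o x y) z) /\
      (forall x y, rmul o x y = rmul o y x) /\
      (forall x y z, rmul o x (radd o y z) = radd o (rmul o x y) (rmul o x z)).

Definition is_rng_hom (T U : Type) (oT : rng_ops T) (oU : rng_ops U)
  (h : T -> U) : Prop :=
  (forall x y, h (radd oT x y) = radd oU (h x) (h y)) /\
  (forall x y, h (rmul oT x y) = rmul oU (h x) (h y)).

Definition gh_ops (A : comPzRingType) : rng_ops (nat -> A) :=
  RngOps (fun a b n => a n + b n) (fun a b n => a n * b n)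
         (fun _ => 0) (fun a n => - a n).

(* Indexing convention: N = {1,2,3,...}; a sequence (a_n)_{n in N} is encoded
   as a : nat -> A with  a k = a_{k+1}. *)

Definition ghost (g : {poly int}) (A : comPzRingType)
  (iota : {rmorphism {poly int} -> A}) (a : nat -> A) : nat -> A :=
  fun n => \sum_(d < n.+2 | (d %| n.+1)%N)
     d%:R * (1 - iota (g ^+ (n.+1 %/ d)%N)) * a d.-1 ^+ (n.+1 %/ d)%N.

(* A candidate functor: for every Z[q]-algebra (A, iota), a ring structure on A^N. *)
Definition Wfam : Type :=
  forall (A : comPzRingType) (iota : {rmorphism {poly int} -> A}), rng_ops (nat -> A).

(* Conditions (1)-(3) (functoriality on morphisms is forced by (2)). *)
Definition Wbar_spec (g : {poly int}) (W : Wfam) : Prop :=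
  (forall (A : comPzRingType) (iota : {rmorphism {poly int} -> A}),
      is_comrng (W A iota)) /\
  (forall (A B : comPzRingType) (iA : {rmorphism {poly int} -> A})
          (iB : {rmorphism {poly int} -> B}) (f : {rmorphism A -> B}),
      (forall p, f (iA p) = iB p) ->
      is_rng_hom (W A iA) (W B iB) (fun a => f \o a)) /\
  (forall (A : comPzRingType) (iota : {rmorphism {poly int} -> A}),
      is_rng_hom (W A iota) (gh_ops A) (ghost g iota)).

(* Main.v *)
Require Import Defs.
From HB Require Import structures.
From mathcomp Require Import all_boot all_order all_algebra.
From mathcomp Require Import ring zify finmap.
From mathcomp.multinomials Require Import monalg.
From Stdlib Require Import FunctionalExtensionality IndefiniteDescription.
Set Implicit Arguments. Unset Strict Implicit. Unset Printing Implicit Defensive.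
Import GRing.Theory Num.Theory.
Local Open Scope ring_scope.

(* Put h = 1 - g.  The ghost vector of a is the logarithmic derivative of
   prod_d (1 - g a_d X^d) / (1 - a_d X^d), and these products are exactly the
   power series congruent to 1 mod hX: the coefficients a_d are peeled off one
   at a time.  Such series form a group, which gives sums and opposites; for
   products it suffices to multiply the ghosts of two factors, which is an
   explicit combination of logarithmic derivatives of series
   (1 - u X^m) / (1 - v X^m) with h | v - u.  In a polynomial algebra over Z[q]
   (infinitely many variables) the ghost map is injective when g <> 1, so the
   sum, product and opposite of generic vectors are unique; every algebra is a
   quotient of a polynomial algebra, so evaluation transports existence, the
   ring axioms and uniqueness.  For g = 1 the ghost map is 0 and the
   componentwise structure works. *)

(** * Logarithmic derivatives of power series modulo [X^(N+1)] *)

Definition eqX (R : nzRingType) (N : nat) (p q : {poly R}) :=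
  forall i, (i <= N)%N -> p`_i = q`_i.

(** The equation [X f' / f = b] with its denominator cleared, so that series can be represented by
    polynomials. *)
Definition logder (R : nzRingType) N (f : {poly R}) (b : nat -> R) :=
  eqX N (f^`() * 'X) (f * \poly_(i < N.+1) b i).

(** The coefficient of [X^n] in [X f' / f] for [f = (1 - u X^m) / (1 - v X^m)]. With [u = g a] and
    [v = a] it is the summand [d = m] of the ghost component [n]. *)
Definition diff_ghost (R : pzRingType) (m : nat) (u v : R) (n : nat) : R :=
  if (m %| n)%N then m%:R * (v ^+ (n %/ m) - u ^+ (n %/ m)) else 0.

Section TruncatedSeries.
Variables (R : comNzRingType) (N : nat).
Implicit Types (p q f e : {poly R}) (b : nat -> R).

Lemma eqX_trans p q r : eqX N p q -> eqX N q r -> eqX N p r.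
Proof. by move=> pq qr i iN; rewrite pq ?qr. Qed.

Lemma eqX_sym p q : eqX N p q -> eqX N q p.
Proof. by move=> pq i iN; rewrite pq. Qed.

Lemma eqXD p q r s : eqX N p q -> eqX N r s -> eqX N (p + r) (q + s).
Proof. by move=> pq rs i iN; rewrite !coefD pq ?rs. Qed.

Lemma eqXM p q r s : eqX N p q -> eqX N r s -> eqX N (p * r) (q * s).
Proof.
move=> pq rs i iN; rewrite !coefM; apply: eq_bigr => -[j /= ji] _.
by rewrite pq ?rs //; lia.
Qed.

Lemma eqX0M p q : eqX N q 0 -> eqX N (p * q) 0.
Proof. by move=> q0; rewrite -(mulr0 p); apply: eqXM. Qed.

Lemma eqX_Xn k p : (N < k)%N -> eqX N ('X^k * p) 0.
Proof. by move=> Nk i iN; rewrite coefXnM coef0 (leq_ltn_trans iN Nk). Qed.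

Lemma eqX_deriv p q : eqX N p q -> eqX N (p^`() * 'X) (q^`() * 'X).
Proof.
move=> pq [|i] iN; rewrite !coefMX //= !coef_deriv pq //; lia.
Qed.

(** The system is unitriangular: coefficient [i] of [p * c] is [p_i] plus terms in lower
    coefficients of [p]. *)
Lemma eqX_cancel p q (c : {poly R}) :
  c`_0 = 1 -> eqX N (p * c) (q * c) -> eqX N p q.
Proof.
move=> c0 pq i; elim/ltn_ind: i => i IH iN.
have := pq i iN; rewrite !coefM !big_ord_recr /= subnn c0 !mulr1.
have -> : \sum_(j < i) p`_j * c`_(i - j) = \sum_(j < i) q`_j * c`_(i - j).
  by apply: eq_bigr => -[j /= ji] _; rewrite IH //; lia.
by move/addrI.
Qed.

Lemma logder_ext f b b' :
  (forall n, (n <= N)%N -> b n = b' n) -> logder N f b -> logder N f b'.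
Proof.
move=> bb' fb; apply: eqX_trans fb _; apply: eqXM => // i iN.
by rewrite !coef_poly ltnS iN bb'.
Qed.

Lemma logderM f f' b b' :
  logder N f b -> logder N f' b' -> logder N (f * f') (fun n => b n + b' n).
Proof.
move=> fb fb'; rewrite /logder derivM mulrDl.
have -> : \poly_(i < N.+1) (b i + b' i)
    = \poly_(i < N.+1) b i + \poly_(i < N.+1) b' i.
  by apply/polyP=> i; rewrite coefD !coef_poly; case: ifP; rewrite ?addr0.
rewrite mulrDr mulrAC [f * f' * _]mulrAC.
rewrite -[f * f'^`() * 'X]mulrA -[f * f' * _]mulrA.
by apply: eqXD; apply: eqXM.
Qed.

(* The series is (1 - u X^m) / (1 - v X^m) modulo X^(N+1). *)
Lemma logder_diff m (u v : R) : (0 < m)%N ->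
  logder N (1 + (v - u)%:P * 'X^m * \sum_(k < N.+1) (v%:P * 'X^m) ^+ k)
    (diff_ghost m u v).
Proof.
move=> m0; rewrite /logder; set T := 'X^m : {poly R}; set f := 1 + _.
set B := \poly_(i < N.+1) _.
have geo w : (1 - w%:P * T) * \sum_(k < N.+1) (w%:P * T) ^+ k
   = 1 - (w%:P * T) ^+ N.+1.
  by rewrite -[RHS]opprB subrX1 -[RHS]mulNr opprB.
have hiT w : eqX N ((w%:P * T) ^+ N.+1) 0.
  by rewrite exprMn -exprM mulrC; apply: eqX_Xn; nia.
have fE : eqX N (f * (1 - v%:P * T)) (1 - u%:P * T).
  have -> : f * (1 - v%:P * T)
     = 1 - u%:P * T + (u%:P - v%:P) * T * (v%:P * T) ^+ N.+1.
    transitivity ((1 - v%:P * T) + (v - u)%:P * T *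
       ((1 - v%:P * T) * \sum_(k < N.+1) (v%:P * T) ^+ k)).
      by rewrite /f -/T; ring.
    by rewrite geo polyCB; ring.
  rewrite -[X in eqX N _ X]addr0; apply: eqXD => //.
  exact: eqX0M.
have dT w : (1 - w%:P * T)^`() * 'X = - (m%:R%:P * w%:P * T).
  rewrite derivB -polyC1 derivC sub0r derivM derivC mul0r add0r derivXn.
  rewrite mulNr mulrnAr mulrnAl -[w%:P * _ * 'X]mulrA -exprSr prednK //.
  by rewrite -mulr_natl polyC_natr mulrA.
(* The product rule applied to [f * (1 - v T) = 1 - u T]. *)
have dfE : eqX N (f^`() * 'X * (1 - v%:P * T) - f * (m%:R%:P * v%:P * T))
   (- (m%:R%:P * u%:P * T)).
  rewrite -dT -(mulrN f) -dT mulrA [f^`() * 'X * _]mulrAC -mulrDl -derivM.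
  exact: eqX_deriv.
have BE : eqX N B (m%:R%:P * (\sum_(k < N.+1) (v%:P * T) ^+ k
                            - \sum_(k < N.+1) (u%:P * T) ^+ k)).
  have coefG w i : (i <= N)%N -> (\sum_(k < N.+1) (w%:P * T) ^+ k)`_i
      = if (m %| i)%N then w ^+ (i %/ m) else 0.
    move=> iN; rewrite coef_sum.
    under eq_bigr => k _ do
      rewrite exprMn -exprM -polyC_exp coefCM coefXn mulr_natr mulrb.
    rewrite -big_mkcond /=; case: ifP => [/dvdnP[k ik] | ndvd].
      have kN : (k < N.+1)%N by rewrite ltnS; nia.
      rewrite (big_pred1 (Ordinal kN)) ?ik ?mulnK // => j /=.
      by rewrite mulnC eqn_mul2l eqn0Ngt m0 /= eq_sym.
    rewrite big_pred0 // => k; apply/negP => /eqP ik.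
    by rewrite ik dvdn_mulr in ndvd.
  move=> i iN; rewrite coef_poly ltnS iN coefCM coefB !coefG // /diff_ghost.
  by case: ifP => // _; rewrite subr0 mulr0.
(* Both geometric series in [B] collapse: [1/(1 - v T) - 1/(1 - u T)] has numerator [(v - u) T]. *)
have BE' : eqX N (B * ((1 - v%:P * T) * (1 - u%:P * T)))
    (m%:R%:P * (v - u)%:P * T).
  apply: eqX_trans (eqXM BE (fun _ _ => erefl)) _.
  move: (geo u) (geo v) (hiT u) (hiT v).
  set Gu := \sum_(k < N.+1) _ ^+ k; set Gv := \sum_(k < N.+1) (v%:P * T) ^+ k.
  set Hu := (u%:P * T) ^+ N.+1; set Hv := (v%:P * T) ^+ N.+1.
  move=> gu gv hu hv.
  have -> : m%:R%:P * (Gv - Gu) * ((1 - v%:P * T) * (1 - u%:P * T))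
     = m%:R%:P * (v - u)%:P * T + (m%:R%:P * (1 - v%:P * T) * Hu
       - m%:R%:P * (1 - u%:P * T) * Hv).
    transitivity (m%:R%:P * (((1 - v%:P * T) * Gv) * (1 - u%:P * T)
          - ((1 - u%:P * T) * Gu) * (1 - v%:P * T))); first by ring.
    by rewrite gu gv polyCB; ring.
  move=> i iN; rewrite [LHS]coefD -[RHS]addr0; congr (_ + _).
  by rewrite coefB !eqX0M ?coef0 ?subr0.
(* Multiplying by [(1 - v T)^2 (1 - u T)], whose constant term is 1, clears every denominator on
   both sides. *)
apply: (@eqX_cancel _ _ ((1 - v%:P * T) * ((1 - v%:P * T) * (1 - u%:P * T)))).
  have c0 w : (1 - w%:P * T)`_0 = 1.
    by rewrite coefB coefCM coefXn ltn_eqF // mulr0 subr0 coef1.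
  by rewrite !coef0M !c0 !mulr1.
have -> : f^`() * 'X * ((1 - v%:P * T) * ((1 - v%:P * T) * (1 - u%:P * T)))
  = (f^`() * 'X * (1 - v%:P * T) - f * (m%:R%:P * v%:P * T))
      * ((1 - v%:P * T) * (1 - u%:P * T))
    + f * (1 - v%:P * T) * (m%:R%:P * v%:P * T * (1 - u%:P * T)) by ring.
have -> : f * B * ((1 - v%:P * T) * ((1 - v%:P * T) * (1 - u%:P * T)))
  = f * (1 - v%:P * T) * (B * ((1 - v%:P * T) * (1 - u%:P * T))) by ring.
apply: eqX_trans (eqX_sym (eqXM fE BE')).
apply: eqX_trans (eqXD (eqXM dfE _) (eqXM fE _)) _; try by [].
by move=> i iN; congr (polyseq _)`_i; rewrite polyCB; ring.
Qed.
End TruncatedSeries.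

(** * Logarithmic derivatives of series congruent to 1 modulo [h X] *)

Section Integrality.
Variables (R : comNzRingType) (g : R) (N : nat).
Implicit Types (e p : {poly R}) (b : nat -> R).
Let h := 1 - g.

(** The index [k] filters the group [1 + h X R[[X]]]: the series starts as [1 + h e_k X^(k+1)], so
    raising [k] records that one more factor has been removed. *)
Definition integral k b := exists2 e : {poly R},
  forall i, (i < k)%N -> e`_i = 0 & logder N (1 + h%:P * ('X * e)) b.

Lemma coefX_low k e p : (forall i, (i < k)%N -> e`_i = 0) ->
  forall i, (i <= k)%N -> ('X * (e * p))`_i = 0.
Proof.
move=> ek [|i] ik; rewrite coefXM //= coefM big1 // => -[j /= ji] _.
by rewrite ek ?mul0r //; lia.
Qed.

Lemma integral_ext k b b' :
  (forall n, (n <= N)%N -> b n = b' n) -> integral k b -> integral k b'.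
Proof. by move=> bb' [e ek /(logder_ext bb')]; exists e. Qed.

Lemma logder_unitM e e' b b' :
  logder N (1 + h%:P * ('X * e)) b -> logder N (1 + h%:P * ('X * e')) b' ->
  logder N (1 + h%:P * ('X * (e + e' + h%:P * ('X * (e * e')))))
    (fun n => b n + b' n).
Proof.
by move=> eb eb'; have := logderM eb eb'; congr (logder N _ _); ring.
Qed.

Lemma integralD k b b' :
  integral k b -> integral k b' -> integral k (fun n => b n + b' n).
Proof.
move=> [e ek eb] [e' ek' eb']; exists (e + e' + h%:P * ('X * (e * e'))).
  move=> i ik; rewrite !coefD coefCM (coefX_low _ ek) 1?ltnW //.
  by rewrite ek ?ek' // mulr0 !addr0.
exact: logder_unitM.
Qed.

Lemma integral0 k : integral k (fun=> 0).
Proof.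
exists 0; first by move=> i _; rewrite coef0.
move=> i _; rewrite !mulr0 addr0 -polyC1 derivC mul0r mul1r coef0 coef_poly.
by case: ifP.
Qed.

Lemma integral_sum (I : Type) (r : seq I) (F : I -> nat -> R) :
  (forall i, integral 0 (F i)) -> integral 0 (fun n => \sum_(i <- r) F i n).
Proof.
move=> Fi; elim: r => [|i r IH].
  by apply: integral_ext (integral0 0) => n _; rewrite big_nil.
by apply: integral_ext (integralD (Fi i) IH) => n _; rewrite big_cons.
Qed.

Lemma integral_natl k b : integral 0 b -> integral 0 (fun n => k%:R * b n).
Proof.
move=> bi; apply: integral_ext (integral_sum (iota 0 k) (fun=> bi)) => n _.
by rewrite big_const_seq count_predT size_iota iter_addr_0 mulr_natl.
Qed.

(** Since [h] divides [v - u], the series [(1 - u X^(m+1)) / (1 - v X^(m+1))] begins with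
    [1 + h w X^(m+1)]. The value of [e_m] is what allows a leading term to be cancelled. *)
Lemma logder_diff_unit m (u v w : R) : v - u = h * w ->
  exists e, [/\ forall i, (i < m)%N -> e`_i = 0, e`_m = w
    & logder N (1 + h%:P * ('X * e)) (diff_ghost m.+1 u v)].
Proof.
move=> uv; exists (w%:P * ('X^m * \sum_(k < N.+1) (v%:P * 'X^(m.+1)) ^+ k)).
split=> [i im||]; first by rewrite coefCM coefXnM im mulr0.
  rewrite coefCM coefXnM ltnn subnn coef_sum big_ord_recl expr0 coef1 eqxx.
  rewrite big1 ?addr0 ?mulr1 // => i _.
  by rewrite lift0 exprS !coef0M coefXn mulr0 mul0r.
have := @logder_diff R N m.+1 u v isT; rewrite uv; congr (logder N _ _).
by rewrite polyCM exprS; ring.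
Qed.

Lemma integral_diff m (u v w : R) : (0 < m)%N -> v - u = h * w ->
  integral 0 (diff_ghost m u v).
Proof.
by case: m => // m _ /(logder_diff_unit m)[e [_ _ eb]]; exists e.
Qed.

(** At level [N] the series is 1 modulo [X^(N+1)], so its logarithmic derivative vanishes up to
    degree [N]. *)
Lemma integral_high b n : integral N b -> (n <= N)%N -> b n = 0.
Proof.
case=> e eN eb nN; have f1 : eqX N (1 + h%:P * ('X * e)) 1.
  move=> i iN; rewrite coefD coefCM -[e]mulr1 (coefX_low _ eN) //.
  by rewrite mulr0 addr0.
have /(_ n nN) : eqX N (1%:P^`() * 'X) (1 * \poly_(i < N.+1) b i).
  apply: eqX_trans (eqX_sym (eqX_deriv f1)) _; apply: eqX_trans eb _.
  exact: eqXM.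
by rewrite derivC mul0r coef0 mul1r coef_poly ltnS nN.
Qed.

(** If the series begins with [1 + h s X^(k+1)], multiplying it by
    [(1 - s X^(k+1)) / (1 - g s X^(k+1))], which begins with [1 - h s X^(k+1)], cancels that
    term. *)
Lemma integral_step k b : integral k b ->
  exists s, integral k.+1 (fun n => b n - diff_ghost k.+1 (g * s) s n).
Proof.
case=> e ek eb; exists e`_k.
have [|e' [ek' e'k eb']] := @logder_diff_unit k e`_k (g * e`_k) (- e`_k).
  by rewrite /h; ring.
exists (e + e' + h%:P * ('X * (e * e'))).
  move=> i; rewrite ltnS => ik; rewrite !coefD coefCM (coefX_low _ ek) // mulr0.
  rewrite addr0; move: ik; rewrite leq_eqVlt => /orP[/eqP->|ik].
    by rewrite e'k subrr.
  by rewrite ek ?ek' // addr0.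
apply: logder_ext (logder_unitM eb eb') => n _; congr (_ + _).
by rewrite /diff_ghost; case: ifP => _; rewrite ?oppr0 // -mulrN opprB.
Qed.

(** Peeling off [N] factors in turn leaves a series of level [N], which contributes nothing in
    degrees up to [N]. *)
Lemma integral_witt b : integral 0 b ->
  exists a : nat -> R, forall n, (n <= N)%N ->
    b n = \sum_(j < N) diff_ghost j.+1 (g * a j) (a j) n.
Proof.
move=> b0; have witt k : exists a : nat -> R,
    integral k (fun n => b n - \sum_(j < k) diff_ghost j.+1 (g * a j) (a j) n).
  elim: k => [|k [a /integral_step[s IH]]].
    by exists (fun=> 0); apply: integral_ext b0 => n _; rewrite big_ord0 subr0.
  exists (fun j => if j == k then s else a j); apply: integral_ext IH => n _.
  rewrite big_ord_recr /= eqxx opprD addrA; congr (_ - _ - _).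
  by apply: eq_bigr => -[j jk] _ /=; rewrite ltn_eqF.
have [a /integral_high ab] := witt N.
by exists a => n /ab/eqP; rewrite subr_eq0 => /eqP.
Qed.

Lemma integral_ghost_factor m a : (0 < m)%N ->
  integral 0 (diff_ghost m (g * a) a).
Proof.
by move=> m0; apply: (@integral_diff m _ _ a) => //; rewrite /h; ring.
Qed.

(** Exchanging [u] and [v] inverts the series and negates its logarithmic derivative. *)
Lemma integral_diffN m a : (0 < m)%N ->
  integral 0 (fun n => - diff_ghost m (g * a) a n).
Proof.
move=> m0; apply: integral_ext (@integral_diff m a (g * a) (- a) m0 _).
  move=> n _; rewrite /diff_ghost; case: ifP => _; rewrite ?oppr0 //.
  by rewrite -mulrN opprB.
by rewrite /h; ring.
Qed.

(** Both sides vanish unless [n = l t]. Then [n/d = i t], [n/e = j t] and [d e = l gcd(d, e)], and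
    with [G = g^t] the factor [(1 - G^i)(1 - G^j)] splits as [(1 - G^i) + (G^(i+j) - G^j)]. *)
Lemma diff_ghostM (d e : nat) x y n : (0 < d)%N -> (0 < e)%N ->
  let l := lcmn d e in let i := (l %/ d)%N in let j := (l %/ e)%N in
  let z := x ^+ i * y ^+ j in
  diff_ghost d (g * x) x n * diff_ghost e (g * y) y n =
  (gcdn d e)%:R * (diff_ghost l (g ^+ i * z) z n
                   + diff_ghost l (g ^+ j * z) (g ^+ (i + j) * z) n).
Proof.
move=> d0 e0 l i j z; rewrite /diff_ghost dvdn_lcm.
case: (boolP (d %| n)%N) => dn /=; last by rewrite mul0r addr0 mulr0.
case: (boolP (e %| n)%N) => en /=; last by rewrite mulr0 addr0 mulr0.
have /dvdnP[t nE] : (l %| n)%N by rewrite dvdn_lcm dn.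
have l0 : (0 < l)%N by rewrite lcmn_gt0 d0.
have nd : (n %/ d = i * t)%N by rewrite nE -muln_divA ?dvdn_lcml // mulnC.
have ne : (n %/ e = j * t)%N by rewrite nE -muln_divA ?dvdn_lcmr // mulnC.
rewrite nd ne nE mulnK // !exprMn -!exprM mulnDl exprD.
have -> : d%:R * (x ^+ (i * t) - g ^+ (i * t) * x ^+ (i * t)) *
  (e%:R * (y ^+ (j * t) - g ^+ (j * t) * y ^+ (j * t)))
  = (d * e)%:R * ((x ^+ (i * t) - g ^+ (i * t) * x ^+ (i * t)) *
     (y ^+ (j * t) - g ^+ (j * t) * y ^+ (j * t))) by rewrite natrM; ring.
rewrite -muln_lcm_gcd natrM -/l; ring.
Qed.

(** In both terms of [diff_ghostM] the difference [v - u] is a multiple of [1 - g^i], hence of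
    [h]. *)
Lemma integral_diffM (d e : nat) x y : (0 < d)%N -> (0 < e)%N ->
  integral 0 (fun n => diff_ghost d (g * x) x n * diff_ghost e (g * y) y n).
Proof.
move=> d0 e0; apply: integral_ext; first by move=> n _; rewrite diff_ghostM.
have l0 : (0 < lcmn d e)%N by rewrite lcmn_gt0 d0.
have hX (k : nat) : 1 - g ^+ k = h * \sum_(i < k) g ^+ i.
  by rewrite -opprB subrX1 -mulNr opprB.
apply/integral_natl/integralD.
  apply: (integral_diff (w := (\sum_(i < lcmn d e %/ d) g ^+ i)
       * (x ^+ (lcmn d e %/ d) * y ^+ (lcmn d e %/ e)))) => //.
  by rewrite [RHS]mulrA -hX; ring.
apply: (integral_diff (w := - (\sum_(i < lcmn d e %/ d) g ^+ i)
  * (g ^+ (lcmn d e %/ e)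
     * (x ^+ (lcmn d e %/ d) * y ^+ (lcmn d e %/ e))))) => //.
by rewrite [RHS]mulrA mulrN -hX exprD; ring.
Qed.

End Integrality.

(** * Ghost components as sums of factors, and their naturality *)

Lemma ghost_sum (p : {poly int}) (A : comPzRingType)
    (iota : {rmorphism {poly int} -> A}) (a : nat -> A) N n : (n < N)%N ->
  ghost p iota a n = \sum_(j < N) diff_ghost j.+1 (iota p * a j) (a j) n.+1.
Proof.
(* The index [d = 0] drops out, as 0 does not divide [n+1]. Extending the range to a common [N] adds
   only non-divisors and lets one list of factors serve every [n < N]. *)
move=> nN; rewrite /ghost big_mkcond big_ord_recl /= add0r.
rewrite (big_ord_widen_cond _ xpredT (fun j : nat =>
  if (j.+1 %| n.+1)%N then j.+1%:R * (1 - iota (p ^+ (n.+1 %/ j.+1))) * a j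
    ^+ (n.+1 %/ j.+1) else 0) nN) big_mkcond.
apply: eq_bigr => -[j /= jN] _; rewrite /diff_ghost.
case: ifP => [_|]; case: ifP => // dv.
  by rewrite rmorphXn exprMn; ring.
by rewrite ltnS => /negP[]; rewrite -ltnS (dvdn_leq _ dv).
Qed.

Lemma ghost0 (p : {poly int}) (A : comPzRingType)
    (iota : {rmorphism {poly int} -> A}) n : ghost p iota (fun=> 0) n = 0.
Proof.
rewrite /ghost big1 // => d dn; have d0 := dvdn_gt0 (isT : 0 < n.+1)%N dn.
by rewrite expr0n eqn0Ngt divn_gt0 ?(dvdn_leq _ dn) ?mulr0.
Qed.

Section GhostMap.
Variables (p : {poly int}) (A B : comPzRingType).
Variables (iA : {rmorphism {poly int} -> A}) (iB : {rmorphism {poly int} -> B}).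
Variable f : {rmorphism A -> B}.
Hypothesis fi : forall q, f (iA q) = iB q.

Lemma ghost_map a n : ghost p iB (f \o a) n = f (ghost p iA a n).
Proof.
rewrite /ghost rmorph_sum; apply: eq_bigr => d _.
by rewrite !rmorphM rmorphB rmorph1 rmorph_nat rmorphXn fi.
Qed.

(** This and the next two lemmas carry identities between generic vectors to any algebra, with [f]
    an evaluation map. *)
Lemma ghost_mapD a b c :
  (forall n, ghost p iA c n = ghost p iA a n + ghost p iA b n) ->
  forall n, ghost p iB (f \o c) n
    = ghost p iB (f \o a) n + ghost p iB (f \o b) n.
Proof. by move=> cE n; rewrite !ghost_map cE rmorphD. Qed.

Lemma ghost_mapM a b c :
  (forall n, ghost p iA c n = ghost p iA a n * ghost p iA b n) ->
  forall n, ghost p iB (f \o c) n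
    = ghost p iB (f \o a) n * ghost p iB (f \o b) n.
Proof. by move=> cE n; rewrite !ghost_map cE rmorphM. Qed.

Lemma ghost_mapN a c : (forall n, ghost p iA c n = - ghost p iA a n) ->
  forall n, ghost p iB (f \o c) n = - ghost p iB (f \o a) n.
Proof. by move=> cE n; rewrite !ghost_map cE rmorphN. Qed.
End GhostMap.

(** * Injectivity and image of the ghost map over algebras where nonzero polynomials act
    regularly *)

Section TorsionFreeGhost.
Variables (p : {poly int}) (R : comNzRingType).
Variable (iota : {rmorphism {poly int} -> R}).
Hypothesis iota_reg : forall q x, q != 0 -> iota q * x = 0 -> x = 0.
Hypothesis p_neq1 : p != 1.

(** The ghost map is triangular: [a n] enters component [n] linearly, with coefficient
    [(n+1)(1 - p)], a nonzero element of [Z[q]] and so regular on [R]. *)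
Lemma ghost_inj_upto N a b :
  (forall n, (n < N)%N -> ghost p iota a n = ghost p iota b n) ->
  forall n, (n < N)%N -> a n = b n.
Proof.
move=> gab; elim/ltn_ind => n IH nN; have := gab n nN.
rewrite !(@ghost_sum _ _ _ _ n.+1) // !big_ord_recr /=.
have -> : \sum_(i < n) diff_ghost i.+1 (iota p * a i) (a i) n.+1
        = \sum_(i < n) diff_ghost i.+1 (iota p * b i) (b i) n.+1.
  by apply: eq_bigr => -[j /= jn] _; rewrite IH //; apply: ltn_trans jn nN.
rewrite /diff_ghost dvdnn divnn /= !expr1 => /addrI/eqP.
rewrite -subr_eq0 => /eqP E.
apply/eqP; rewrite -subr_eq0; apply/eqP.
apply: (@iota_reg (n.+1%:R * (1 - p))).
  rewrite mulf_neq0 //; last by rewrite subr_eq0 eq_sym.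
  by rewrite -polyC_natr polyC_eq0 pnatr_eq0.
rewrite -{}[RHS]E rmorphM rmorphB rmorph1 rmorph_nat; ring.
Qed.

Lemma ghost_inj a b :
  (forall n, ghost p iota a n = ghost p iota b n) -> a = b.
Proof.
move=> gab; apply: functional_extensionality => n.
exact: (@ghost_inj_upto n.+1).
Qed.

(** By injectivity, solutions for different bounds agree where both are constrained, so they glue
    into one sequence. *)
Lemma ghost_lift (b : nat -> R) :
  (forall N, exists a, forall n, (n < N)%N -> ghost p iota a n = b n) ->
  exists a, forall n, ghost p iota a n = b n.
Proof.
move=> ex.
pose c N := proj1_sig (constructive_indefinite_description _ (ex N)).
have cE N n : (n < N)%N -> ghost p iota (c N) n = b n.
  by rewrite /c; case: constructive_indefinite_description => /= a; apply.
(* The diagonal: [c n.+1] is the first chosen solution whose entry [n] is determined. *)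
exists (fun n => c n.+1 n) => n; rewrite -(cE n.+1) //.
rewrite !(@ghost_sum _ _ _ _ n.+1) //; apply: eq_bigr => -[j /= jn] _.
have -> // : c j.+1 j = c n.+1 j.
apply: (@ghost_inj_upto j.+1) => // i ij; rewrite !cE //.
exact: leq_trans ij jn.
Qed.

Lemma integral_ghost (b : nat -> R) :
  (forall N, exists2 c, integral (iota p) N 0 c
     & forall n, (n < N)%N -> c n.+1 = b n) ->
  exists a, forall n, ghost p iota a n = b n.
Proof.
move=> bi; apply: ghost_lift => N; have [c /integral_witt[a ac] cb] := bi N.
by exists a => n nN; rewrite (@ghost_sum _ _ _ _ N) // -ac ?cb.
Qed.

Lemma ghostD a b : exists c, forall n,
  ghost p iota c n = ghost p iota a n + ghost p iota b n.
Proof.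
apply: integral_ghost => N.
exists (fun n => \sum_(j < N) diff_ghost j.+1 (iota p * a j) (a j) n
               + \sum_(j < N) diff_ghost j.+1 (iota p * b j) (b j) n).
  by apply: integralD; apply: integral_sum => j; apply: integral_ghost_factor.
by move=> n nN; rewrite -!ghost_sum.
Qed.

Lemma ghostN a : exists c, forall n, ghost p iota c n = - ghost p iota a n.
Proof.
apply: integral_ghost => N.
exists (fun n => \sum_(j < N) - diff_ghost j.+1 (iota p * a j) (a j) n).
  by apply: integral_sum => j; apply: integral_diffN.
by move=> n nN; rewrite sumrN -ghost_sum.
Qed.

(** Expanding the product of two sums of factors leaves the pairwise products treated by
    [integral_diffM]. *)
Lemma ghostM a b : exists c, forall n,
  ghost p iota c n = ghost p iota a n * ghost p iota b n.
Proof.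
apply: integral_ghost => N.
exists (fun n => \sum_(i < N) \sum_(j < N)
  diff_ghost i.+1 (iota p * a i) (a i) n
    * diff_ghost j.+1 (iota p * b j) (b j) n).
  by do 2!apply: integral_sum => ?; apply: integral_diffM.
by move=> n nN; rewrite !(ghost_sum _ _ _ nN) big_distrlr.
Qed.
End TorsionFreeGhost.

(** * Polynomial algebras over [Z[q]] and their evaluation maps *)

Section FreeAlgebra.
Variable I : choiceType.
Implicit Types (m : cmonom I) (i : I).

Definition monom_eval (A : comPzRingType) (v : I -> A) m : A :=
  \prod_(i <- finsupp m) v i ^+ m i.

(** The explicit sum makes sense over the zero ring too; over a nontrivial ring it is [mmap]. *)
Definition malg_eval (A : comPzRingType) (iota : {rmorphism {poly int} -> A})
    (v : I -> A) (u : {malg {poly int}[cmonom I]}) : A :=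
  \sum_(m <- msupp u) iota u@_m * monom_eval v m.

Lemma monom_evalEw (A : comPzRingType) (v : I -> A) (d : {fset I}) m :
  (finsupp m `<=` d)%fset -> monom_eval v m = \prod_(i <- d) v i ^+ m i.
Proof.
move=> le; rewrite /monom_eval (big_fset_incl _ le) // => i _.
by rewrite -cmE_neq0 negbK => /eqP ->; rewrite expr0.
Qed.

Lemma monom_eval_mmorphism (A : comNzRingType) (v : I -> A) :
  mmorphism (monom_eval v).
Proof.
split; last by rewrite /monom_eval mdom1 big_seq_fset0.
move=> m1 m2; rewrite {1}/monom_eval mdomD.
rewrite (monom_evalEw _ (fsubsetUl _ (finsupp m2))).
rewrite (monom_evalEw _ (fsubsetUr (finsupp m1) _)).
by rewrite -big_split; apply: eq_bigr => i _; rewrite cmM exprD.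
Qed.

HB.instance Definition _ (A : comNzRingType) (v : I -> A) :=
  isMultiplicative.Build (cmonom I) A (monom_eval v) (monom_eval_mmorphism v).

(* [mmap] only targets nontrivial rings; the zero ring is treated apart. *)
Lemma comNz_of_neq0 (A : comPzRingType) : 1 != 0 :> A ->
  exists B : comNzRingType, B = A :> comPzRingType.
Proof.
case: A => T c T_nz.
pose A := GRing.ComPzRing.Pack c.
pose B : comNzRingType := HB.pack T (GRing.PzSemiRing_isNonZero.Build A T_nz) c.
by exists B.
Qed.

(** Over the zero ring every equation holds, which leaves nontrivial rings. *)
Lemma comPz_ind (P : comPzRingType -> Prop) :
    (forall A : comPzRingType, (forall x y : A, x = y) -> P A) ->
    (forall A : comNzRingType, P A) ->
  forall A : comPzRingType, P A.
Proof.
move=> triv nontriv A; have [A0|] := eqVneq (1 : A) 0.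
  by apply: triv => x y; rewrite -[x]mulr1 -[y]mulr1 A0 !mulr0.
by case/comNz_of_neq0 => B <-.
Qed.

Lemma malg_eval_zmod_morphism (A : comPzRingType)
    (iota : {rmorphism {poly int} -> A}) (v : I -> A) :
  zmod_morphism (malg_eval iota v).
Proof.
elim/comPz_ind: A iota v => [A triv iota v x y|A iota v]; first exact: triv.
exact: (raddfB (mmap iota (monom_eval v))).
Qed.

Lemma malg_eval_monoid_morphism (A : comPzRingType)
    (iota : {rmorphism {poly int} -> A}) (v : I -> A) :
  monoid_morphism (malg_eval iota v).
Proof.
elim/comPz_ind: A iota v => [A triv iota v|A iota v].
  by split=> [|x y]; apply: triv.
split; first exact: (rmorph1 (mmap iota (monom_eval v))).
exact: (rmorphM (mmap iota (monom_eval v))).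
Qed.

HB.instance Definition _ (A : comPzRingType)
    (iota : {rmorphism {poly int} -> A}) (v : I -> A) :=
  GRing.isZmodMorphism.Build {malg {poly int}[cmonom I]} A (malg_eval iota v)
    (malg_eval_zmod_morphism iota v).
HB.instance Definition _ (A : comPzRingType)
    (iota : {rmorphism {poly int} -> A}) (v : I -> A) :=
  GRing.isMonoidMorphism.Build {malg {poly int}[cmonom I]} A (malg_eval iota v)
    (malg_eval_monoid_morphism iota v).

Lemma malg_evalC (A : comPzRingType) (iota : {rmorphism {poly int} -> A})
    (v : I -> A) c : malg_eval iota v c%:MP = iota c.
Proof.
elim/comPz_ind: A iota v => [A triv iota v|A iota v]; first exact: triv.
exact: (@mmapC _ _ _ iota (monom_eval v)).
Qed.

Lemma malg_evalU (A : comPzRingType) (iota : {rmorphism {poly int} -> A})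
    (v : I -> A) i : malg_eval iota v << ucm i >> = v i.
Proof.
elim/comPz_ind: A iota v => [A triv iota v|A iota v]; first exact: triv.
rewrite -[LHS]/(mmap iota (monom_eval v) _) mmapU /= rmorph1 mul1r.
by rewrite /monom_eval mdomU big_seq_fset1 cmUU.
Qed.

Lemma malg_eval_comp (A B : comPzRingType) (iA : {rmorphism {poly int} -> A})
    (iB : {rmorphism {poly int} -> B}) (f : {rmorphism A -> B}) (v : I -> A) u :
  (forall p, f (iA p) = iB p) ->
  f (malg_eval iA v u) = malg_eval iB (f \o v) u.
Proof.
move=> fi; rewrite /malg_eval rmorph_sum; apply: eq_bigr => m _.
rewrite rmorphM fi rmorph_prod; congr (_ * _).
by apply: eq_bigr => i _; rewrite rmorphXn.
Qed.

(** Coefficientwise, this is the absence of zero divisors in [Z[q]]. *)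
Lemma malgC_reg (c : {poly int}) (u : {malg {poly int}[cmonom I]}) :
  c != 0 -> c%:MP * u = 0 -> u = 0.
Proof.
move=> c0 cu; apply/malgP => m; have := congr1 (mcoeff m) cu.
rewrite mcoeffCM !mcoeff0 => /eqP.
by rewrite mulf_eq0 (negPf c0) => /eqP.
Qed.
End FreeAlgebra.

Definition free_alg (I : choiceType) : comNzRingType :=
  {malg {poly int}[cmonom I]}.

Definition free_const (I : choiceType) : {rmorphism {poly int} -> free_alg I} :=
  @malgC (cmonom I) {poly int}.

Definition free_var (I : choiceType) (i : I) : free_alg I := << ucm i >>.

Definition free_eval (I : choiceType) (A : comPzRingType)
    (iota : {rmorphism {poly int} -> A}) (v : I -> A) :
  {rmorphism free_alg I -> A} := malg_eval iota v.

Lemma free_const_reg (I : choiceType) c (u : free_alg I) :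
  c != 0 -> free_const I c * u = 0 -> u = 0.
Proof. exact: malgC_reg. Qed.

Section FreeEval.
Variables (I : choiceType) (A : comPzRingType).
Variables (iota : {rmorphism {poly int} -> A}) (v : I -> A).

Lemma free_evalC c : free_eval iota v (free_const I c) = iota c.
Proof. exact: malg_evalC. Qed.

Lemma free_eval_var i : free_eval iota v (free_var i) = v i.
Proof. exact: malg_evalU. Qed.

Lemma free_eval_comp (B : comPzRingType) (iB : {rmorphism {poly int} -> B})
    (f : {rmorphism A -> B}) u : (forall q, f (iota q) = iB q) ->
  f (free_eval iota v u) = free_eval iB (f \o v) u.
Proof. exact: malg_eval_comp. Qed.
End FreeEval.

(** With one variable for each element of [A], evaluation at [id] presents [A] as a quotient of a
    polynomial algebra, and every vector over [A] lifts to a vector of variables. *)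
Lemma free_evalK (A : comPzRingType) (iota : {rmorphism {poly int} -> A})
    (a : nat -> A) : free_eval iota id \o (fun n => free_var (a n)) = a.
Proof. by apply: functional_extensionality => n; apply: free_eval_var. Qed.

(** * Existence and uniqueness of the functor *)

Section Wbar.
Variable p : {poly int}.
Hypothesis p_neq1 : p != 1.

Lemma free_ghost_inj (I : choiceType) (a b : nat -> free_alg I) :
  (forall n, ghost p (free_const I) a n = ghost p (free_const I) b n) -> a = b.
Proof. exact: ghost_inj (@free_const_reg I) p_neq1 _ _. Qed.

Lemma Wbar_exists : exists W : Wfam, Wbar_spec p W.
Proof.
(* Two families of variables form the generic vectors [x] and [y]; [s], [t], [o] are their universal
   sum and product and the opposite of [x]. *)
pose J : choiceType := (bool * nat)%type.
pose x (n : nat) : free_alg J := free_var (true, n).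
pose y (n : nat) : free_alg J := free_var (false, n).
have [s sE] := ghostD (iota := free_const J) (@free_const_reg J) p_neq1 x y.
have [t tE] := ghostM (iota := free_const J) (@free_const_reg J) p_neq1 x y.
have [o oE] := ghostN (iota := free_const J) (@free_const_reg J) p_neq1 x.
pose val (A : comPzRingType) (a b : nat -> A) (k : J) :=
  if k.1 then a k.2 else b k.2.
pose W : Wfam := fun A iota => RngOps
  (fun a b n => free_eval iota (val A a b) (s n))
  (fun a b n => free_eval iota (val A a b) (t n))
  (fun=> 0)
  (* The identity defining [o] mentions [x] alone, so any value could be given to [y]; [a] is at
     hand. *)
  (fun a n => free_eval iota (val A a a) (o n)).
have vx A iota a b : free_eval iota (val A a b) \o x = a.
  by apply: functional_extensionality => n; apply: free_eval_var.
have vy A iota a b : free_eval iota (val A a b) \o y = b.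
  by apply: functional_extensionality => n; apply: free_eval_var.
(* Otherwise unification compares [x] with [y] by unfolding the free algebra. *)
clearbody x y.
have gD A iota a b n : ghost p iota (radd (W A iota) a b) n
    = ghost p iota a n + ghost p iota b n.
  have := ghost_mapD (free_evalC iota (val A a b)) sE n.
  by rewrite (vx A iota a b) (vy A iota a b).
have gM A iota a b n : ghost p iota (rmul (W A iota) a b) n
    = ghost p iota a n * ghost p iota b n.
  have := ghost_mapM (free_evalC iota (val A a b)) tE n.
  by rewrite (vx A iota a b) (vy A iota a b).
have gN A iota a n : ghost p iota (ropp (W A iota) a) n = - ghost p iota a n.
  have := ghost_mapN (free_evalC iota (val A a a)) oE n.
  by rewrite (vx A iota a a).
have val_comp (A B : comPzRingType) (f : A -> B) a b :
    f \o val A a b = val B (f \o a) (f \o b).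
  by apply: functional_extensionality => -[[] k].
have nD (A B : comPzRingType) (iA : {rmorphism {poly int} -> A})
    (iB : {rmorphism {poly int} -> B}) (f : {rmorphism A -> B}) a b : (forall q, f (iA q) = iB q) ->
  f \o radd (W A iA) a b = radd (W B iB) (f \o a) (f \o b).
  move=> fi; apply: functional_extensionality => n /=.
  by rewrite (free_eval_comp _ _ fi) val_comp.
have nM (A B : comPzRingType) (iA : {rmorphism {poly int} -> A})
    (iB : {rmorphism {poly int} -> B}) (f : {rmorphism A -> B}) a b : (forall q, f (iA q) = iB q) ->
  f \o rmul (W A iA) a b = rmul (W B iB) (f \o a) (f \o b).
  move=> fi; apply: functional_extensionality => n /=.
  by rewrite (free_eval_comp _ _ fi) val_comp.
have nN (A B : comPzRingType) (iA : {rmorphism {poly int} -> A})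
    (iB : {rmorphism {poly int} -> B}) (f : {rmorphism A -> B}) a : (forall q, f (iA q) = iB q) ->
  f \o ropp (W A iA) a = ropp (W B iB) (f \o a).
  move=> fi; apply: functional_extensionality => n /=.
  by rewrite (free_eval_comp _ _ fi) val_comp.
have z0 (A : comPzRingType) (iota : {rmorphism {poly int} -> A}) :
  rzero (W A iota) = fun=> 0 by [].
clearbody W; exists W; split; [|split]; last first.
- by move=> A iota; split=> a b; apply: functional_extensionality => n;
    rewrite ?gD ?gM.
- by move=> A B iA iB f fi; split=> a b; [apply: nD | apply: nM].
(* The ring axioms are pulled back along the surjection [pi] from the polynomial algebra on the
   elements of [A]. *)
move=> A iota; pose pi := free_eval iota id.
have piC q : pi (free_const A q) = iota q by exact: free_evalC.
have surj (P : (nat -> A) -> Prop) :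
    (forall c : nat -> free_alg A, P (pi \o c)) -> forall a, P a.
  by move=> Pc a; rewrite -(free_evalK iota a).
clearbody pi.
have pi0 : rzero (W A iota) = pi \o rzero (W (free_alg A) (free_const A)).
  by rewrite !z0; apply: functional_extensionality => n; rewrite /= raddf0.
have D a b := esym (nD _ _ _ _ pi a b piC).
have M a b := esym (nM _ _ _ _ pi a b piC).
have N a := esym (nN _ _ _ _ pi a piC).
(* Each vector is lifted, naturality moves [pi] outside, and injectivity of the ghost map reduces
   each axiom to the same axiom in the polynomial algebra, component by component. *)
do !split; do ![elim/surj=> ?]; rewrite ?pi0 !(D, M, N); congr (pi \o _);
  apply: free_ghost_inj => n; rewrite !(gD, gM, gN) ?z0 ?ghost0.
- exact: addrA.
- exact: addrC.
- exact: add0r.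
- exact: addNr.
- exact: mulrA.
- exact: mulrC.
- exact: mulrDr.
Qed.

(** Condition (3) and injectivity fix sums and products over the polynomial algebra on [A];
    condition (2) for the surjection onto [A] then fixes them over [A]. *)
Lemma Wbar_unique (W1 W2 : Wfam) : Wbar_spec p W1 -> Wbar_spec p W2 ->
  forall (A : comPzRingType) (iota : {rmorphism {poly int} -> A}),
    W1 A iota = W2 A iota.
Proof.
move=> [rng1 [nat1 gh1]] [rng2 [nat2 gh2]] A iota.
have piC q : free_eval iota id (free_const A q) = iota q.
  exact: free_evalC.
have [D1 M1] := nat1 _ _ _ _ _ piC; have [D2 M2] := nat2 _ _ _ _ _ piC.
have [gD1 gM1] := gh1 _ (free_const A); have [gD2 gM2] := gh2 _ (free_const A).
have D a b : radd (W1 A iota) a b = radd (W2 A iota) a b.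
  rewrite -(free_evalK iota a) -(free_evalK iota b) -D1 -D2; congr (_ \o _).
  by apply: free_ghost_inj => n; rewrite gD1 gD2.
have M a b : rmul (W1 A iota) a b = rmul (W2 A iota) a b.
  rewrite -(free_evalK iota a) -(free_evalK iota b) -M1 -M2; congr (_ \o _).
  by apply: free_ghost_inj => n; rewrite gM1 gM2.
have := rng1 A iota; have := rng2 A iota.
case: (W1 A iota) (W2 A iota) D M => [d1 m1 z1 o1] [d2 m2 z2 o2] /= D M.
have {D}<- : d1 = d2 by do 2!apply: functional_extensionality => ?.
have {M}<- : m1 = m2 by do 2!apply: functional_extensionality => ?.
rewrite /is_comrng /= => -[dA [dC [d0 [dN _]]]] [_ [_ [d0' [dN' _]]]].
(* Zero, and then opposites, are determined by the addition. *)
have z12 : z1 = z2 by rewrite -[LHS]d0 dC d0'.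
subst z2.
have <- // : o1 = o2.
apply: functional_extensionality => a.
by rewrite -[LHS]d0 -(dN a) -dA (dC a) dN' dC d0.
Qed.
End Wbar.

Lemma Wbar_exists1 : exists W : Wfam, Wbar_spec 1 W.
Proof.
exists (fun A _ => gh_ops A); split; [|split] => [A _|A B iA iB f _|A iota].
- do !split; move=> *; apply: functional_extensionality => n /=; ring.
- by split=> a b; apply: functional_extensionality => n /=;
    rewrite ?rmorphD ?rmorphM.
have gh0 a : ghost 1 iota a = fun=> 0.
  apply: functional_extensionality => n; rewrite /ghost big1 // => d _.
  by rewrite expr1n rmorph1 subrr mulr0 mul0r.
by split=> a b; rewrite !gh0; apply: functional_extensionality => n /=; ring.
Qed.

Theorem theorem3p5 (g : {poly int}) :
  (exists W : Wfam, Wbar_spec g W) /\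
  (g != 1 -> forall W1 W2 : Wfam, Wbar_spec g W1 -> Wbar_spec g W2 ->
     forall (A : comPzRingType) (iota : {rmorphism {poly int} -> A}),
       W1 A iota = W2 A iota).
Proof.
split; last exact: Wbar_unique.
by have [->|] := eqVneq g 1; [apply: Wbar_exists1 | apply: Wbar_exists].
Qed.
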